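(* Consider the gossip dynamics with stubborn agents and block communication probabilities described in the context, and assume: $0<n_{r1}\le n_1$, $0<n_{r2}\le n_2$; $w_s,w_d>0$, $w_s\ne w_d$, $w_s(n_1^2+n_2^2)+2w_dn_1n_2=1$; the stubborn initial vector $\mathbf{x}^s=[(\mathbf{x}^{s1})^T\ (\mathbf{x}^{s2})^T]^T$ is fixed; $n_{s1},n_{s2}>0$ and $\frac1{n_{s1}}\mathbf{1}^T\mathbf{x}^{s1}\neq\frac1{n_{s2}}\mathbf{1}^T\mathbf{x}^{s2}$; and for every stubborn agent $i$ a regular agent $j_i$ in the same community as $i$ is known. Run the algorithm described in the context. Then: (i) the community detection part converges in finite time: almost surely there is a finite (random) time $T$ and a permutation $\pi$ of $\{1,2\}$ such that $\hat{\mathcal{C}}(i,t)=\pi(\mathcal{C}(i))$ for all $i\in\mathcal{V}$ and all $t\ge T$, where $\mathcal{C}(i)=k$ iff $i\in\mathcal{V}_k$; (ii) the parameter estimation part converges almost surely: $\mathbb{P}\{\lim_{t\to\infty}(\hat w_s(t),\hat w_d(t))=(w_s,w_d)\}=1$.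
   Context: Model: agents $\mathcal{V}=\{1,\dots,n\}$, $n=n_1+n_2$, in two communities $\mathcal{V}_1=\{1,\dots,n_1\}$, $\mathcal{V}_2=\{n_1+1,\dots,n\}$ (the community structure and $n_1,n_2$ are unknown to the algorithm; $n$ is known). Community $k$ has $n_{rk}$ regular agents $\mathcal{V}_{rk}$ and $n_{sk}=n_k-n_{rk}$ stubborn agents $\mathcal{V}_{sk}$; $\mathcal{V}_r=\mathcal{V}_{r1}\cup\mathcal{V}_{r2}$ and $\mathcal{V}_s=\mathcal{V}_{s1}\cup\mathcal{V}_{s2}$ are known. Let $w_{ij}=w_s$ if $i,j$ are in the same community and $w_d$ otherwise. For $i,j\in\mathcal{V}$: $R^{ij}=I-\frac12(\mathbf{e}_i-\mathbf{e}_j)(\mathbf{e}_i-\mathbf{e}_j)^T$ if both regular; $R^{ij}=I-\frac12\mathbf{e}_i(\mathbf{e}_i-\mathbf{e}_j)^T$ if $i$ regular, $j$ stubborn; $R^{ij}=I-\frac12\mathbf{e}_j(\mathbf{e}_j-\mathbf{e}_i)^T$ if $i$ stubborn, $j$ regular; $R^{ij}=I$ if both stubborn. At each $t\in\mathbb{N}$, independently, an ordered pair $(i,j)$ is drawn with probability $w_{ij}$ and $x(t+1)=R^{ij}x(t)$, from a fixed $x(0)$; stubborn states stay constant, $x^s(t)\equiv\mathbf{x}^s$; $x^r(t)$ denotes the vector of regular agents' states. Algorithm (input: the trajectory $x^r(t)$, $\mathbf{x}^s$, and the map $i\mapsto j_i$): initialize $\hat{\mathcal{C}}(i,0),\hat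 w_s(0),\hat w_d(0)$ arbitrarily and $s^r(0)=x^r(0)$. For $t=1,2,\dots$: $s^r(t)=\frac{t}{t+1}s^r(t-1)+\frac1{t+1}x^r(t)$ and $\bar s^r(t)=\frac1{|\mathcal{V}_r|}\mathbf{1}^Ts^r(t)$. Community detection: $\hat{\mathcal{C}}(i,t)=2-\mathbb{I}_{[s^r_i(t)>\bar s^r(t)]}$ for $i\in\mathcal{V}_r$, and $\hat{\mathcal{C}}(i,t)=\hat{\mathcal{C}}(j_i,t)$ for $i\in\mathcal{V}_s$. Let $\hat n_k(t)=|\{i\in\mathcal{V}:\hat{\mathcal{C}}(i,t)=k\}|$, $\hat{\mathcal{V}}_{rk}(t)=\{i\in\mathcal{V}_r:\hat{\mathcal{C}}(i,t)=k\}$, $\hat{\mathcal{V}}_{sk}(t)=\{i\in\mathcal{V}_s:\hat{\mathcal{C}}(i,t)=k\}$, $\beta_1(t)=\frac{|\hat{\mathcal{V}}_{s1}(t)|}{|\hat{\mathcal{V}}_{r1}(t)|}\sum_{i\in\hat{\mathcal{V}}_{r1}(t)}s^r_i(t)-\sum_{i\in\hat{\mathcal{V}}_{s1}(t)}x_i(t)$, $\beta_2(t)=\frac{\hat n_2(t)}{|\hat{\mathcal{V}}_{r1}(t)|}\sum_{i\in\hat{\mathcal{V}}_{r1}(t)}s^r_i(t)-\sum_{i\in\hat{\mathcal{V}}_{r2}(t)}s^r_i(t)-\sum_{i\in\hat{\mathcal{V}}_{s2}(t)}x_i(t)$, $g(t)=\beta_1(t)-\frac{\hat n_1^2(t)+\hat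 n_2^2(t)}{2\hat n_1(t)\hat n_2(t)}\beta_2(t)$. Parameter estimation: $\tilde w_s(t)=\hat w_s(t-1)-\frac1t\,\mathrm{sgn}(g(t))\big(g(t)\hat w_s(t-1)+\frac{\beta_2(t)}{2\hat n_1(t)\hat n_2(t)}\big)$; $\hat w_s(t)=\tilde w_s(t)$ if $|\tilde w_s(t)|<2$ and $\hat w_s(t)=\frac12$ otherwise; $\hat w_d(t)=\frac{1-(\hat n_1^2(t)+\hat n_2^2(t))\hat w_s(t)}{2\hat n_1(t)\hat n_2(t)}$. *)

(* Defs.v *)
From HB Require Import structures.
From mathcomp Require Import all_boot all_order all_algebra.
From mathcomp Require Import all_classical all_reals all_analysis.
Set Implicit Arguments. Unset Strict Implicit. Unset Printing Implicit Defensive.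
Import Order.TTheory GRing.Theory Num.Theory.
Local Open Scope ring_scope.

(* Agents are 'I_(n1+n2); community 1 = {0,...,n1-1}, community 2 = the rest
   (0-based version of the paper's {1..n1}, {n1+1..n}).  Community labels are
   the naturals 1 and 2 as in the paper.  S is the set of stubborn agents. *)
Section Gossip.
Variable R : realType.
Variables n1 n2 : nat.
Local Notation n := (n1 + n2)%N.

Definition comm (i : 'I_n) : nat := if (i < n1)%N then 1%N else 2%N.

(* probability w_{ij} of drawing the ordered pair (i,j) *)
Definition wpair (ws wd : R) (p : 'I_n * 'I_n) : R :=
  if comm p.1 == comm p.2 then ws else wd.

Variable S : {set 'I_n}.

Definition Vr (k : nat) : {set 'I_n} := [set i in ~: S | comm i == k].
Definition Vs (k : nat) : {set 'I_n} := [set i in S | comm i == k].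

Definition evec (i : 'I_n) : 'cV[R]_n := delta_mx i 0.

Definition Rmat (i j : 'I_n) : 'M[R]_n :=
  if (i \notin S) && (j \notin S) then
    1%:M - 2^-1 *: ((evec i - evec j) *m (evec i - evec j)^T)
  else if (i \notin S) && (j \in S) then
    1%:M - 2^-1 *: (evec i *m (evec i - evec j)^T)
  else if (i \in S) && (j \notin S) then
    1%:M - 2^-1 *: (evec j *m (evec j - evec i)^T)
  else 1%:M.

Variable x0 : 'cV[R]_n.

Fixpoint traj (p : nat -> 'I_n * 'I_n) (t : nat) : 'cV[R]_n :=
  match t with
  | 0 => x0
  | t'.+1 => Rmat (p t').1 (p t').2 *m traj p t'
  end.

Definition stub_avg (k : nat) : R :=
  #|Vs k|%:R^-1 * \sum_(i in Vs k) x0 i 0.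

Variable jmap : 'I_n -> 'I_n.
Variable C0 : 'I_n -> nat.
Variables ws0 wd0 : R.

Section Algo.
Variable p : nat -> 'I_n * 'I_n.

(* s^r(t) (only regular entries are used) *)
Fixpoint savg (t : nat) : 'I_n -> R :=
  match t with
  | 0 => fun i => traj p 0 i 0
  | t'.+1 => fun i => (t'.+1%:R / t'.+2%:R) * savg t' i + t'.+2%:R^-1 * traj p t'.+1 i 0
  end.

Definition sbar (t : nat) : R := #|~: S|%:R^-1 * \sum_(i in ~: S) savg t i.

Definition lab (t : nat) (i : 'I_n) : nat := if sbar t < savg t i then 1%N else 2%N.

Definition Chat (t : nat) (i : 'I_n) : nat :=
  match t with
  | 0 => C0 i
  | _ => if i \in S then lab t (jmap i) else lab t i
  end.

Definition nhat (t k : nat) : R := #|[set i | Chat t i == k]|%:R.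
Definition Vrh (t k : nat) : {set 'I_n} := [set i in ~: S | Chat t i == k].
Definition Vsh (t k : nat) : {set 'I_n} := [set i in S | Chat t i == k].

Definition beta1 (t : nat) : R :=
  #|Vsh t 1|%:R / #|Vrh t 1|%:R * \sum_(i in Vrh t 1) savg t i
  - \sum_(i in Vsh t 1) traj p t i 0.

Definition beta2 (t : nat) : R :=
  nhat t 2 / #|Vrh t 1|%:R * \sum_(i in Vrh t 1) savg t i
  - \sum_(i in Vrh t 2) savg t i - \sum_(i in Vsh t 2) traj p t i 0.

Definition gfun (t : nat) : R :=
  beta1 t - (nhat t 1 ^+ 2 + nhat t 2 ^+ 2) / (2 * nhat t 1 * nhat t 2) * beta2 t.

Fixpoint wshat (t : nat) : R :=
  match t with
  | 0 => ws0
  | t'.+1 =>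
    let prev := wshat t' in
    let wt := prev - t'.+1%:R^-1 * Num.sg (gfun t'.+1)
                     * (gfun t'.+1 * prev + beta2 t'.+1 / (2 * nhat t'.+1 1 * nhat t'.+1 2)) in
    if `|wt| < 2 then wt else 2^-1
  end.

Definition wdhat (t : nat) : R :=
  match t with
  | 0 => wd0
  | _ => (1 - (nhat t 1 ^+ 2 + nhat t 2 ^+ 2) * wshat t) / (2 * nhat t 1 * nhat t 2)
  end.
End Algo.
End Gossip.

(* Main.v *)
Require Import Defs.
From HB Require Import structures.
From mathcomp Require Import all_boot all_order all_algebra.
From mathcomp Require Import all_classical all_reals all_analysis.
From mathcomp Require Import ring lra.
Import Order.TTheory GRing.Theory Num.Theory.
Import numFieldNormedType.Exports.
Local Open Scope ring_scope.
Local Open Scope classical_set_scope.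

(* For a regular agent [i], the increment of [x_i] minus its conditional mean
   [drift_i(x) = sum_j w_ij (x_j - x_i)] is a bounded martingale difference.
   Summing over time and dividing by [t], the strong law of large numbers for
   bounded martingale differences and the boundedness of [x] give
   [sum_j w_ij (s_j(t) - s_i(t)) --> 0] almost surely.  This is an asymptotically
   solved linear system: averaged over each community, it becomes a 2x2 system
   with positive determinant, so [s_i(t)] converges to a limit [a_k] depending
   only on the community [k] of [i].  As the stubborn averages differ and
   [ws <> wd], [a_1 <> a_2]; hence comparing with the overall mean eventually
   yields the right labels.  From then on the estimator is a stochastic
   approximation recursion with steps of order [1/t] towards [ws]. *)

(** * A strong law for bounded martingale differences of an i.i.d. sequence *)

Lemma root4 (t : nat) : exists k, (k ^ 4 <= t < k.+1 ^ 4)%N.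
Proof.
have ex : exists k, (k ^ 4 <= t)%N by exists 0%N.
have ub k : (k ^ 4 <= t)%N -> (k <= t)%N.
  by apply: leq_trans; case: k => // k; rewrite -{1}(expn1 k.+1) leq_pexp2l.
exists (ex_maxn ex ub); case: ex_maxnP => k -> max /=.
by rewrite ltnNge; apply/negP => /max; rewrite ltnn.
Qed.

(** For [k ^ 4 <= t < k.+1 ^ 4], the value at [k ^ 4] is at most [k ^ 3] in modulus and the
    increments up to [t] add O(k^3), while [t >= k ^ 4]. *)
Lemma cvg_div_quartic_subseq (R : realType) (M : nat -> R) (C : R) :
  (forall t, `|M t.+1 - M t| <= C) ->
  (\forall n \near \oo, M (n ^ 4)%N ^+ 2 <= n%:R ^+ 6) ->
  (fun t => M t / t%:R) @ \oo --> (0 : R).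
Proof.
move=> inc [N _ hN].
have C0 : 0 <= C := le_trans (normr_ge0 _) (inc 0%N).
have incj a j : `|M (a + j)%N - M a| <= C * j%:R.
  elim: j => [|j IH]; first by rewrite addn0 subrr normr0 mulr0.
  rewrite addnS -[M _ - _](subrKA (M (a + j)%N)) (le_trans (ler_normD _ _))//.
  by rewrite -natr1 mulrDr mulr1 addrC lerD.
apply/cvgrPdist_le => e e0.
(* The first argument yields [k >= N] and [k >= 1], the second [1 + 15 * C <= k * e]. *)
pose K := maxn N.+1 (Num.bound ((1 + 15 * C) / e)).
exists (K ^ 4)%N => //= t Kt; rewrite sub0r normrN.
have [k /andP[kt tk]] := root4 t.
have Kk : (K <= k)%N by rewrite -ltnS -(@ltn_exp2r _ _ 4)// (leq_ltn_trans Kt).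
have Nk : (N <= k)%N by rewrite (leq_trans _ Kk)// leq_max leqnSn.
have k1 : 1 <= k%:R :> R by rewrite ler1n (leq_trans _ Kk)// leq_max.
have k0 : 0 < k%:R :> R by rewrite (lt_le_trans _ k1).
have t0 : 0 < t%:R :> R.
  by rewrite ltr0n (leq_trans _ kt)// expn_gt0 -(ltr0n R) k0.
have Mk : `|M (k ^ 4)%N| <= k%:R ^+ 3.
  rewrite -ler_sqr ?nnegrE ?exprn_ge0 ?ler0n// real_normK ?num_real// -exprM.
  exact: hN.
(* The constant is 15 = 4 + 6 + 4 + 1, from expanding [(k + 1) ^ 4 - k ^ 4] with [k >= 1]. *)
have Mt : `|M t| <= (1 + 15 * C) * k%:R ^+ 3.
  rewrite -[M t](subrK (M (k ^ 4)%N)) (le_trans (ler_normD _ _))//.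
  rewrite addrC mulrDl mul1r lerD//.
  have := incj (k ^ 4)%N (t - k ^ 4)%N; rewrite subnKC// => /le_trans; apply.
  rewrite [15 * C]mulrC -mulrA ler_wpM2l//.
  have : (t - k ^ 4 <= k.+1 ^ 4 - k ^ 4)%N by rewrite leq_sub2r// ltnW.
  rewrite -(ler_nat R) => /le_trans; apply.
  rewrite natrB ?leq_exp2r// !natrX -natr1.
  have k2 : k%:R <= k%:R ^+ 3 :> R by rewrite ler_eXnr.
  have k3 : k%:R ^+ 2 <= k%:R ^+ 3 :> R by rewrite ler_weXn2l.
  set x := k%:R in k1 k2 k3 *.
  have -> : (x + 1) ^+ 4 - x ^+ 4 = 4 * x ^+ 3 + 6 * x ^+ 2 + 4 * x + 1 by ring.
  lra.
have b : (1 + 15 * C) / e <= k%:R.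
  apply: le_trans (_ : (Num.bound ((1 + 15 * C) / e))%:R <= _).
    by apply/ltW/archi_boundP; rewrite divr_ge0 ?(ltW e0)//; lra.
  by rewrite ler_nat (leq_trans _ Kk)// leq_maxr.
rewrite normrM normfV (gtr0_norm t0) ler_pdivrMr// (le_trans Mt)//.
rewrite ler_pdivrMr// in b.
apply: le_trans (_ : k%:R * e * k%:R ^+ 3 <= _); first by rewrite ler_wpM2r// exprn_ge0// ltW.
rewrite mulrC mulrA -exprSr mulrC ler_wpM2l ?(ltW e0)//.
by rewrite -natrX ler_nat.
Qed.

Section CoordinateProcess.
Context (R : realType) (d : measure_display) (T : measurableType d).
Context (P : probability T R) (A : finType) (w : A -> R) (X : nat -> T -> A).

(** As [A] is finite, the cylinders [cyl t q] are the atoms of the past of time [t]. Conditional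
    expectation given that past is then a finite sum over the values [a] in [upd q t a], and no
    conditional expectation operator is required. *)
Definition upd (q : nat -> A) (t : nat) (a : A) : nat -> A :=
  fun s => if s == t then a else q s.

Definition adapted {U : Type} (t : nat) (F : (nat -> A) -> U) :=
  forall q q', (forall s, (s < t)%N -> q s = q' s) -> F q = F q'.

Definition cyl (t : nat) (q : nat -> A) : set T :=
  [set o | forall s, (s < t)%N -> X s o = q s].

Hypothesis w_ge0 : forall a, 0 <= w a.
Hypothesis sum_w : \sum_a w a = 1.
Hypothesis X_law : forall t q, measurable (cyl t q) /\
  P (cyl t q) = (\prod_(s < t) w (q s))%:E.

Lemma cylS t q : cyl t q = \big[setU/set0]_a cyl t.+1 (upd q t a).
Proof.
apply/seteqP; split => o.
  move=> ho; rewrite -bigcup_seq; exists (X t o); first by rewrite /= mem_index_enum.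
  move=> s; rewrite ltnS leq_eqVlt => /orP[/eqP ->|st]; first by rewrite /upd eqxx.
  by rewrite /upd ltn_eqF// ho.
rewrite -bigcup_seq => -[a _ ho] s st.
by rewrite ho; [rewrite /upd ltn_eqF|exact: leqW].
Qed.

Lemma prod_upd t q a :
  \prod_(s < t.+1) w (upd q t a s) = (\prod_(s < t) w (q s)) * w a.
Proof.
rewrite big_ord_recr /= /upd eqxx; congr (_ * _).
by apply: eq_bigr => s _; rewrite ltn_eqF.
Qed.

Lemma measurable_bigsetU_le (I : Type) (r : seq I) (F : I -> set T) (u : I -> R) :
  (forall i, measurable (F i) /\ (P (F i) <= (u i)%:E)%E) ->
  measurable (\big[setU/set0]_(i <- r) F i) /\
  (P (\big[setU/set0]_(i <- r) F i) <= (\sum_(i <- r) u i)%:E)%E.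
Proof.
move=> h; elim: r => [|i r [m1 le1]]; first by rewrite !big_nil measure0; split.
have [m2 le2] := h i.
rewrite !big_cons; split; first exact: measurableU.
by rewrite (le_trans (measureU2 _ m2 m1))// EFinD leeD.
Qed.

(* If [Phi] grows by at most [c] per step in conditional mean, then
   [E (Phi t) <= Phi 0 + c * t], and this is Markov's inequality for it,
   conditioned on a cylinder so that an induction on [k] goes through. *)
Lemma markov_cyl (Phi : nat -> (nat -> A) -> R) (c lam : R) :
  (forall t, adapted t (Phi t)) -> (forall t q, 0 <= Phi t q) ->
  0 <= c -> 0 < lam ->
  (forall t q, \sum_a w a * Phi t.+1 (upd q t a) <= Phi t q + c) ->
  forall k t q,
  measurable (cyl t q `&` [set o | lam <= Phi (k + t)%N (X^~ o)]) /\
  (P (cyl t q `&` [set o | (lam <= Phi (k + t)%N (X^~ o))%R]) <=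
   ((\prod_(s < t) w (q s)) * ((Phi t q + c * k%:R) / lam))%:E)%E.
Proof.
move=> adP P0 c0 l0 step; elim=> [|k IH] t q.
  have Pw0 : 0 <= \prod_(s < t) w (q s) by apply: prodr_ge0.
  (* By adaptedness [Phi t] is constant on the cylinder, so the event is either the whole cylinder
     or empty. *)
  have [hl|hl] := lerP lam (Phi t q).
    have -> : cyl t q `&` [set o | lam <= Phi (0 + t)%N (X^~ o)] = cyl t q.
      apply/seteqP; split => o; first by case.
      by move=> ho; split => //=; rewrite (adP t _ q).
    have [? ->] := X_law t q; split => //.
    rewrite lee_fin ler_peMr// mulr0 addr0 ler_pdivlMr// mul1r//.
  have -> : cyl t q `&` [set o | lam <= Phi (0 + t)%N (X^~ o)] = set0.
    apply/seteqP; split => o //= [ho].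
    by rewrite (adP t _ q)// leNgt hl.
  split => //; rewrite measure0 lee_fin mulr_ge0// divr_ge0 ?addr_ge0 ?mulr_ge0//.
  exact: ltW.
(* Split according to draw [t], use the induction hypothesis from time [t.+1] on each piece, and
   average with [step]. *)
pose F a := cyl t.+1 (upd q t a) `&` [set o | lam <= Phi (k.+1 + t)%N (X^~ o)].
have -> : cyl t q `&` [set o | lam <= Phi (k.+1 + t)%N (X^~ o)] =
    \big[setU/set0]_a F a by rewrite cylS big_distrl.
have hF a : measurable (F a) /\ (P (F a) <= ((\prod_(s < t) w (q s)) * w a *
    ((Phi t.+1 (upd q t a) + c * k%:R) / lam))%:E)%E.
  by rewrite /F addSnnS -prod_upd; exact: IH.
have [mF leF] := measurable_bigsetU_le _ (index_enum A) F _ hF.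
split => //; rewrite (le_trans leF)// lee_fin.
under eq_bigr do rewrite -mulrA mulrA -mulrA; rewrite -mulr_sumr.
apply: ler_wpM2l; first exact: prodr_ge0.
under eq_bigr do rewrite mulrA; rewrite -mulr_suml ler_wpM2r ?invr_ge0 ?(ltW l0)//.
under eq_bigr do rewrite mulrDr; rewrite big_split/= -mulr_suml sum_w mul1r.
by rewrite -natr1 mulrDr mulr1 [_ + c]addrC addrA lerD2r step.
Qed.

Lemma sum_inv_sqr_le2 n : \sum_(i < n) (i.+1%:R ^+ 2)^-1 <= 2 :> R.
Proof.
(* This strengthening telescopes; at [n = 0] it holds because the inverse of 0 is 0. *)
suff: \sum_(i < n) (i.+1%:R ^+ 2)^-1 <= 2 - n%:R^-1 :> R.
  by move=> /le_trans; apply; rewrite gerBl invr_ge0.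
elim: n => [|[|n] IH]; first by rewrite big_ord0 invr0 subr0.
  by rewrite big_ord1 expr1n invr1; lra.
rewrite big_ord_recr /= (le_trans (lerD IH (lexx _)))//.
rewrite -addrA lerD2l -[n.+2%:R]natr1; set x : R := n.+1%:R.
have x0 : 0 < x by rewrite ltr0n.
have -> : - x^-1 + ((x + 1) ^+ 2)^-1 = - (x + 1)^-1 - (x * (x + 1) ^+ 2)^-1.
  by field; rewrite ?gt_eqF// addr_gt0.
by rewrite gerBl invr_ge0 mulr_ge0 ?exprn_ge0 ?addr_ge0// ltW.
Qed.

(* Chebyshev at the times [n ^ 4] with threshold [n ^ 3] for the partial sums:
   the probabilities are O(1 / n^2), hence Borel-Cantelli applies, while both
   [n ^ 3] and the gap to the next such time are negligible before [n ^ 4]. *)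
Lemma bounded_martingale_slln (m : nat -> (nat -> A) -> R) (C : R) :
  (forall t, adapted t.+1 (m t)) -> (forall t q, `|m t q| <= C) ->
  (forall t q, \sum_a w a * m t (upd q t a) = 0) ->
  {ae P, forall o,
    (fun t => (\sum_(s < t) m s (X^~ o)) / t%:R) @ \oo --> (0 : R)}.
Proof.
move=> adm mC m0.
pose M t q := \sum_(s < t) m s q.
have adM t : adapted t (M t).
  move=> q q' qq'; apply: eq_bigr => s _; apply: adm => r rs.
  by apply: qq'; exact: leq_trans rs _.
(* [A] is inhabited since the weights sum to 1; [q0] serves to write the whole space as
   [cyl 0 q0]. *)
have [q0 _] : exists q : nat -> A, True.
  case: (pickP (@predT A)) => [a _|A0]; first by exists (fun=> a).
  by move/eqP: sum_w; rewrite big_pred0// eq_sym oner_eq0.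
(* Orthogonality of martingale differences: the cross term has zero conditional mean, so the second
   moment grows by at most [C ^+ 2]. *)
have step t q : \sum_a w a * (M t.+1 (upd q t a)) ^+ 2 <= M t q ^+ 2 + C ^+ 2.
  have Mu a : M t.+1 (upd q t a) = M t q + m t (upd q t a).
    rewrite /M big_ord_recr /=; congr (_ + _).
    by apply: (adM t) => s st; rewrite /upd ltn_eqF.
  have e a : w a * (M t.+1 (upd q t a)) ^+ 2 = M t q ^+ 2 * w a +
      (M t q *+ 2 * (w a * m t (upd q t a)) + w a * m t (upd q t a) ^+ 2).
    by rewrite Mu sqrrD; ring.
  under eq_bigr do rewrite e.
  rewrite big_split -mulr_sumr sum_w mulr1 big_split -mulr_sumr m0 mulr0 /= add0r.
  rewrite lerD2l -[C ^+ 2]mul1r -sum_w mulr_suml; apply: ler_sum => a _.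
  by rewrite ler_wpM2l// -real_normK ?num_real// lerXn2r ?nnegrE// (le_trans _ (mC t q)).
pose F (n : nat) := [set o | (n.+1%:R ^+ 6 <= M (n.+1 ^ 4)%N (X^~ o) ^+ 2)%R].
have hF n : measurable (F n) /\ (P (F n) <= (C ^+ 2 * (n.+1%:R ^+ 2)^-1)%:E)%E.
  have n0 : 0 < n.+1%:R ^+ 6 :> R by rewrite exprn_gt0.
  have adM2 t : adapted t (fun q => M t q ^+ 2).
    by move=> q q' qq'; rewrite (adM t _ _ qq').
  have M0 : M 0%N q0 = 0 by rewrite /M big_ord0.
  have := markov_cyl (fun t q => M t q ^+ 2) _ _ adM2 (fun _ _ => sqr_ge0 _)
    (sqr_ge0 _) n0 step (n.+1 ^ 4)%N 0%N q0.
  have -> : cyl 0 q0 = setT by apply/seteqP; split.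
  rewrite setTI addn0 big_ord0 mul1r M0 expr0n add0r => -[mF leF].
  split => //; apply: le_trans leF _.
  rewrite lee_fin natrX -mulrA ler_wpM2l ?sqr_ge0// le_eqVlt; apply/orP; left.
  have : n.+1%:R != 0 :> R by rewrite pnatr_eq0.
  by move: n.+1%:R => x x0; apply/eqP; field.
have Ffin : (\sum_(n <oo) P (F n) < +oo)%E.
  apply: (@le_lt_trans _ _ (C ^+ 2 * 2)%:E); last by rewrite ltry.
  apply: lime_le; first by apply: is_cvg_nneseries.
  apply: nearW => n; rewrite big_mkord.
  apply: (@le_trans _ _ (\sum_(i < n) C ^+ 2 * (i.+1%:R ^+ 2)^-1)%:E).
    by rewrite -sumEFin; apply: lee_sum => i _; exact: (hF i).2.
  by rewrite lee_fin -mulr_sumr ler_wpM2l ?sqr_ge0// sum_inv_sqr_le2.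
have mF n : measurable (F n) := (hF n).1.
(* The exceptional set is the event that infinitely many [F n] occur, null by Borel-Cantelli. *)
exists (lim_sup_set F); split.
- by apply: bigcap_measurable => // k _; apply: bigcup_measurable.
- exact: lim_sup_set_cvg0.
move=> o /= no; apply: contrapT => nlim; apply: no.
apply: (cvg_div_quartic_subseq _ (fun t => M t (X^~ o)) C).
  by move=> t; rewrite /M big_ord_recr /= addrAC subrr add0r.
have [N hN] : exists N, forall n, (N <= n)%N -> ~ F n o.
  apply: contrapT => h; apply: nlim => N _.
  apply: contrapT => h'; apply: h; exists N => n Nn Fn; apply: h'.
  by exists n.
exists N.+1 => // -[//|n] /= Nn; rewrite leNgt; apply/negP => /ltW h.
exact: hN n Nn h.
Qed.

End CoordinateProcess.

(** * Stochastic approximation *)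

Lemma cvg_harmonic_pinfty (R : realType) :
  series (@harmonic R) @ \oo --> +oo.
Proof.
apply: nondecreasing_dvgn_lt; last exact: dvg_harmonic.
by apply/nondecreasing_seqP => n; rewrite /series /= big_nat_recr //= lerDl invr_ge0.
Qed.

(* [z t * (1 + gam * (H t - H N))] is nonincreasing, where [H] is the
   (divergent) harmonic sum: this replaces the estimate of an infinite product. *)
Lemma cvg0_harmonic_contraction (R : realType) (z : nat -> R) (gam : R) :
  0 < gam -> (forall t, 0 <= z t) ->
  (\forall t \near \oo, z t.+1 <= (1 - gam / t.+1%:R) * z t) ->
  z @ \oo --> 0.
Proof.
move=> g0 z0 [N _ hN].
pose H := series (@harmonic R).
have HS t : H t.+1 = H t + t.+1%:R^-1.
  by rewrite /H /series /= big_nat_recr.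
have Hmono t : (N <= t)%N -> H N <= H t.
  move=> Nt; rewrite /H /series /= (big_cat_nat _ Nt)//= lerDl sumr_ge0//.
have pot t : (N <= t)%N -> z t * (1 + gam * (H t - H N)) <= z N.
  move=> /subnKC <-; elim: (t - N)%N => [|k IH].
    by rewrite addn0 subrr mulr0 addr0 mulr1.
  rewrite addnS; set u := (N + k)%N in IH *.
  apply: le_trans IH; have Nu : (N <= u)%N by exact: leq_addr.
  have a0 : 0 <= gam / u.+1%:R by rewrite divr_ge0// ltW.
  have b0 : 0 <= gam * (H u - H N) by rewrite mulr_ge0 ?subr_ge0 ?Hmono// ltW.
  have -> : 1 + gam * (H u.+1 - H N) = 1 + gam * (H u - H N) + gam / u.+1%:R.
    by rewrite HS; ring.
  apply: le_trans (ler_wpM2r _ (hN u Nu)) _; first by rewrite !addr_ge0.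
  move: (gam / u.+1%:R) (gam * (H u - H N)) a0 b0 => a b a0 b0; rewrite -subr_ge0.
  have -> : z u * (1 + b) - (1 - a) * z u * (1 + b + a) = z u * (a * (a + b)).
    by ring.
  by rewrite !mulr_ge0// addr_ge0.
apply/cvgrPdist_le => e e0.
(* Beyond this level [z N <= e * gam * (H t - H N)], and [pot] then gives [z t <= e]. *)
have := @cvg_harmonic_pinfty R => /cvgryPge/(_ (H N + z N / (e * gam))) [K _ hK].
exists (maxn N K) => // t /=; rewrite geq_max => /andP[Nt Kt].
rewrite sub0r normrN ger0_norm//.
have p0 : 0 < 1 + gam * (H t - H N).
  by rewrite ltr_pwDl// mulr_ge0 ?subr_ge0 ?Hmono// ltW.
rewrite -(ler_pM2r p0) (le_trans (pot t Nt))//.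
have := hK t Kt; rewrite -/(H t) -lerBrDl ler_pdivrMr ?mulr_gt0// => /le_trans; apply.
by rewrite mulrDr mulr1 mulrC -mulrA lerDr ltW.
Qed.

(** With [v = - c / g], which tends to [wl], the sign factor turns the update into a convex
    combination of the old iterate and [v], with weight [|g| / t] at time [t]. Eventually both lie
    in (-2, 2), so the reset to 1/2 no longer occurs, and the error contracts at a harmonic rate. *)
Lemma cvg_truncated_robbins_monro (R : realType) (g c w : nat -> R) (gl wl : R) :
  g @ \oo --> gl -> gl != 0 -> c @ \oo --> - (gl * wl) -> `|wl| < 2 ->
  (forall t, w t.+1 =
    let wt := w t - t.+1%:R^-1 * Num.sg (g t.+1) * (g t.+1 * w t + c t.+1) in
    if `|wt| < 2 then wt else 2^-1) ->
  w @ \oo --> wl.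
Proof.
move=> cg gl0 cc wl2 rec.
have w2 t : `|w t.+1| < 2.
  by rewrite rec /=; case: ifPn => // _; rewrite gtr0_norm ?invr_gt0//; lra.
pose v t : R := - c t / g t.
have cv : v @ \oo --> wl.
  have -> : wl = - - (gl * wl) / gl by rewrite opprK mulrC mulKf.
  by apply: cvgM; [exact: cvgN|exact: cvgV].
have ngl : 0 < `|gl| by rewrite normr_gt0.
have cng : (fun t => `|g t|) @ \oo --> `|gl| by exact: cvg_norm.
have gl2 : `|gl| / 2 < `|gl| by rewrite gtr_pMr// invf_lt1// ltr1n.
have near_g : \forall t \near \oo, `|gl| / 2 < `|g t| by exact: (cvgr_gt _ cng).
have near_g' : \forall t \near \oo, `|g t| < `|gl| + 1.
  by apply: (cvgr_lt _ cng); rewrite ltrDl.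
have near_v2 : \forall t \near \oo, `|v t| < 2.
  by apply: (cvgr_lt _ (cvg_norm cv)).
have near_t : \forall t \near \oo, `|gl| + 1 <= t%:R by exact: nbhs_infty_ger.
apply/cvgrPdist_le => e e0.
have e20 : 0 < e / 2 by rewrite divr_gt0.
have near_v : \forall t \near \oo, `|wl - v t| <= e / 2.
  by move/cvgrPdist_le : cv; apply.
(* Only the excess over [e / 2] contracts cleanly: the error of [v], eventually at most [e / 2], is
   absorbed. *)
pose z t : R := Num.max (`|wl - w t| - e / 2) 0.
suff : z @ \oo --> 0.
  move=> /cvgrPdist_le /(_ _ e20); apply: filterS => t; rewrite sub0r normrN.
  rewrite ger0_norm ?le_max ?lexx ?orbT// ge_max => /andP[h _]; lra.
apply: (cvg0_harmonic_contraction _ _ (`|gl| / 2)); first by rewrite divr_gt0.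
  by move=> t; rewrite le_max lexx orbT.
have : \forall t \near \oo, [/\ `|gl| / 2 < `|g t|, `|g t| < `|gl| + 1, `|v t| < 2,
    `|gl| + 1 <= t%:R & `|wl - v t| <= e / 2].
  by near=> t; split; near: t.
(* The start [w 0] is arbitrary, so the index is kept positive for [w2] to apply. *)
move=> [N _ hN]; exists N.+1 => // -[//|t] Nt.
have [g1 g2 v2 tl vl] := hN t.+2 (ltnW (leqW Nt)).
move: (rec t.+1); set x := t.+2%:R in tl *.
have x0 : 0 < x by rewrite (lt_le_trans _ tl)// addr_gt0.
set a := `|g t.+2| / x.
have a1 : a <= 1 by rewrite /a ler_pdivrMr// mul1r (le_trans (ltW g2)).
have agam : `|gl| / 2 / x <= a by rewrite /a ler_pM2r ?invr_gt0// ltW.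
have gn0 : g t.+2 != 0 by rewrite -normr_gt0 (le_lt_trans _ g1)// divr_ge0// ltW.
have a0 : 0 <= a by rewrite /a divr_ge0// ltW.
have -> : w t.+1 - x^-1 * Num.sg (g t.+2) * (g t.+2 * w t.+1 + c t.+2) =
    (1 - a) * w t.+1 + a * v t.+2.
  rewrite /a [`|_|]normrEsg /v; field.
  by rewrite gn0 gt_eqF.
clearbody a v; rewrite /= ifT; last first.
  rewrite (le_lt_trans (ler_normD _ _))// !normrM (ger0_norm a0) ger0_norm ?subr_ge0//.
  have := w2 t; move: `|w _| `|v _| v2 => p q q2 p2.
  have : (1 - a) * p + a * q <= (1 - a) * Num.max p q + a * Num.max p q.
    by rewrite lerD// ler_wpM2l ?subr_ge0 ?le_max ?lexx ?orbT.
  by rewrite -mulrDl subrK mul1r => /le_lt_trans; apply; rewrite gt_max p2.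
move=> wE.
have z'z : `|wl - w t.+2| - e / 2 <= (1 - a) * z t.+1.
  have -> : wl - w t.+2 = (1 - a) * (wl - w t.+1) + a * (wl - v t.+2).
    by rewrite wE; ring.
  have h1 : `|wl - w t.+1| - e / 2 <= z t.+1 by rewrite le_max lexx.
  have h2 : (1 - a) * (`|wl - w t.+1| - e / 2) <= (1 - a) * z t.+1.
    by rewrite ler_wpM2l// subr_ge0.
  have h3 : a * `|wl - v t.+2| <= a * (e / 2) by rewrite ler_wpM2l.
  have := ler_normD ((1 - a) * (wl - w t.+1)) (a * (wl - v t.+2)).
  rewrite !normrM (ger0_norm a0) (ger0_norm (_ : 0 <= 1 - a)) ?subr_ge0// => h4.
  lra.
have zt0 : 0 <= z t.+1 by rewrite le_max lexx orbT.
rewrite {1}/z ge_max; apply/andP; split.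
  by rewrite (le_trans z'z)// ler_wpM2r// lerD2l lerN2.
by rewrite mulr_ge0// subr_ge0 (le_trans agam).
Unshelve. all: by end_near.
Qed.

(** * Mean dynamics of the gossip process *)

Section GossipMean.
Context (R : realType) (n1 n2 : nat).
Local Notation n := (n1 + n2)%N.
Context (S : {set 'I_n}) (x0 : 'cV[R]_n) (ws wd : R).

Lemma rank1_update (u v : 'cV[R]_n) (x : 'cV[R]_n) i :
  ((1%:M - 2^-1 *: (u *m v^T)) *m x) i 0 =
  x i 0 - 2^-1 * (u i 0 * (v^T *m x) 0 0).
Proof.
rewrite mulmxBl mul1mx -scalemxAl -mulmxA [LHS]mxE; congr (_ + _).
rewrite [LHS]mxE; congr (- _); rewrite [LHS]mxE; congr (_ * _).
by rewrite [LHS]mxE big_ord1.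
Qed.

Lemma evecB_mul (a b : 'I_n) (x : 'cV[R]_n) :
  ((evec R a - evec R b)^T *m x) 0 0 = x a 0 - x b 0.
Proof.
rewrite linearB /= /evec !trmx_delta mulmxBl !mxE.
rewrite (bigD1 a)//= (bigD1 (P := xpredT) b)//= !mxE !eqxx !mul1r.
by rewrite !big1 ?addr0// => i /negPf ia; rewrite mxE eqxx ia mul0r.
Qed.

Lemma evecE (a i : 'I_n) : evec R a i 0 = (a == i)%:R.
Proof. by rewrite /evec mxE eqxx andbT eq_sym. Qed.

Lemma evecBE (a b i : 'I_n) :
  (evec R a - evec R b) i 0 = (a == i)%:R - (b == i)%:R.
Proof. by rewrite mxE evecE; congr (_ + _); rewrite mxE evecE. Qed.

(* One formula for all the cases of [Rmat] (it is also right for [p.1 = p.2]). *)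
Lemma Rmat_regular (i : 'I_n) (p : 'I_n * 'I_n) (x : 'cV[R]_n) : i \notin S ->
  (Rmat R S p.1 p.2 *m x) i 0 = x i 0 + 2^-1 *
    ((p.1 == i)%:R * (x p.2 0 - x i 0) + (p.2 == i)%:R * (x p.1 0 - x i 0)).
Proof.
case: p => a b iS /=; rewrite /Rmat.
have outS c : c \in S -> (c == i) = false.
  by move=> cS; apply: contraNF iS => /eqP <-.
case: (boolP (a \in S)) => aS; case: (boolP (b \in S)) => bS /=;
  rewrite ?mul1mx ?rank1_update ?evecB_mul ?evecBE ?evecE.
- by rewrite !outS// !mul0r addr0 mulr0 addr0.
- by rewrite (outS a)//; case: (eqVneq b i) => [->|_] /=; ring.
- by rewrite (outS b)//; case: (eqVneq a i) => [->|_] /=; ring.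
- by case: (eqVneq a i) => [->|_]; case: (eqVneq b i) => [->|_] /=; ring.
Qed.

Lemma Rmat_stubborn (i a b : 'I_n) (x : 'cV[R]_n) : i \in S ->
  (Rmat R S a b *m x) i 0 = x i 0.
Proof.
move=> iS; rewrite /Rmat.
have outS c : c \notin S -> (c == i) = false.
  by move=> cS; apply: contraNF cS => /eqP ->.
case: (boolP (a \in S)) => aS; case: (boolP (b \in S)) => bS /=;
  rewrite ?mul1mx ?rank1_update ?evecB_mul ?evecBE ?evecE//.
- by rewrite outS// mul0r mulr0 subr0.
- by rewrite outS// mul0r mulr0 subr0.
- by rewrite !outS// subrr mul0r mulr0 subr0.
Qed.

Definition drift (i : 'I_n) (x : 'cV[R]_n) : R :=
  \sum_j wpair ws wd (i, j) * (x j 0 - x i 0).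

Definition noise (i : 'I_n) (t : nat) (q : nat -> 'I_n * 'I_n) : R :=
  traj S x0 q t.+1 i 0 - traj S x0 q t i 0 - drift i (traj S x0 q t).

Lemma wpair_sym (i j : 'I_n) : wpair ws wd (i, j) = wpair ws wd (j, i).
Proof. by rewrite /wpair /= eq_sym. Qed.

(** Agent [i] may be drawn first or second; by symmetry of the weights each case contributes half of
    the drift. *)
Lemma mean_jump (i : 'I_n) (x : 'cV[R]_n) :
  \sum_p wpair ws wd p * (2^-1 *
    ((p.1 == i)%:R * (x p.2 0 - x i 0) + (p.2 == i)%:R * (x p.1 0 - x i 0)))
  = drift i x.
Proof.
pose f (a b : 'I_n) := 2^-1 * (wpair ws wd (a, b) * ((a == i)%:R * (x b 0 - x i 0))).
have fE : \sum_a \sum_b f a b = 2^-1 * drift i x.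
  rewrite (bigD1 i)//= [X in _ + X]big1 ?addr0.
    by rewrite /f -mulr_sumr; congr (_ * _); apply: eq_bigr => b _; rewrite eqxx mul1r.
  move=> a /negPf ai; rewrite big1// => b _.
  by rewrite /f ai mul0r !mulr0.
rewrite -(pair_bigA _ (fun a b => wpair ws wd (a, b) * (2^-1 *
    ((a == i)%:R * (x b 0 - x i 0) + (b == i)%:R * (x a 0 - x i 0)))))/=.
transitivity (\sum_a \sum_b f a b + \sum_a \sum_b f b a).
  rewrite -big_split /=; apply: eq_bigr => a _; rewrite -big_split /=.
  apply: eq_bigr => b _; rewrite /f (wpair_sym b); ring.
rewrite [X in _ + X]exchange_big fE /=; lra.
Qed.

Lemma sum_comm (F : nat -> R) :
  \sum_(i < n) F (comm i) = n1%:R * F 1%N + n2%:R * F 2%N.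
Proof.
rewrite big_split_ord /=.
have -> : \sum_(i < n1) F (comm (lshift n2 i)) = n1%:R * F 1%N.
  under eq_bigr => i _ do rewrite /comm /= ltn_ord.
  by rewrite sumr_const card_ord mulr_natl.
have -> : \sum_(i < n2) F (comm (rshift n1 i)) = n2%:R * F 2%N.
  under eq_bigr => i _ do rewrite /comm /= ltnNge leq_addr /=.
  by rewrite sumr_const card_ord mulr_natl.
by [].
Qed.

Hypothesis normalization :
  ws * (n1%:R ^+ 2 + n2%:R ^+ 2) + 2 * wd * n1%:R * n2%:R = 1.

Lemma sum_wpair : \sum_(p : 'I_n * 'I_n) wpair ws wd p = 1 :> R.
Proof.
pose G (k l : nat) : R := if k == l then ws else wd.
rewrite -(pair_bigA _ (fun a b : 'I_n => wpair ws wd (a, b))) /=.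
under eq_bigr => a _ do rewrite (sum_comm (G (comm a))).
rewrite (sum_comm (fun k => n1%:R * G k 1%N + n2%:R * G k 2%N)) /G /= -[RHS]normalization.
ring.
Qed.

Hypothesis ws0 : 0 < ws.
Hypothesis wd0 : 0 < wd.

Lemma wpair_ge0 (p : 'I_n * 'I_n) : 0 <= wpair ws wd p :> R.
Proof. by rewrite /wpair; case: ifP => _; exact: ltW. Qed.

Lemma traj_adapted t : adapted ('I_n * 'I_n)%type t (fun q => traj S x0 q t).
Proof.
elim: t => [//|t IH] q q' qq' /=.
by rewrite qq'// (IH q q')// => s st; apply: qq'; exact: leqW.
Qed.

(** Each new state is an old state or the mean of two, so a common bound on the entries persists. *)
Lemma traj_bound q t (i : 'I_n) : `|traj S x0 q t i 0| <= \sum_j `|x0 j 0|.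
Proof.
elim: t i => [|t IH] i.
  by rewrite (bigD1 i)//= lerDl sumr_ge0.
rewrite [traj _ _ _ _]/=; set y := traj S x0 q t in IH *.
have [iS|iS] := boolP (i \in S); first by rewrite Rmat_stubborn.
rewrite Rmat_regular//; set K := \sum_j _ in IH *.
have := IH (q t).2; have := IH (q t).1; have := IH i; rewrite !ler_norml.
case: eqVneq => [->|_]; case: eqVneq => [->|_] /= /andP[? ?] /andP[? ?] /andP[? ?];
  apply/andP; split; lra.
Qed.

Lemma noise_adapted i t : adapted ('I_n * 'I_n)%type t.+1 (noise i t).
Proof.
move=> q q' qq'; rewrite /noise (traj_adapted t.+1 _ _ qq') (traj_adapted t q q')//.
by move=> s st; apply: qq'; exact: leqW.
Qed.

Lemma noise_bound : exists C, forall i t q, `|noise i t q| <= C.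
Proof.
pose K := \sum_j `|x0 j 0|.
(* The increment takes [K + K]; summing over all pairs bounds the drift uniformly in [i]. *)
exists (K + K + \sum_(p : 'I_n * 'I_n) wpair ws wd p * (K + K)) => i t q.
have B t' j : `|traj S x0 q t' j 0| <= K := traj_bound q t' j.
have B2 t' j l : `|traj S x0 q t' j 0 - traj S x0 q t l 0| <= K + K.
  by rewrite (le_trans (ler_normB _ _))// lerD.
rewrite /noise (le_trans (ler_normB _ _))// lerD ?B2//.
rewrite /drift (le_trans (ler_norm_sum _ _ _))//.
rewrite -(pair_bigA _ (fun a b => wpair ws wd (a, b) * (K + K))) /= [leRHS](bigD1 i)//=.
rewrite ler_wpDr//.
  apply: sumr_ge0 => a _; apply: sumr_ge0 => b _; rewrite mulr_ge0 ?wpair_ge0//.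
  by rewrite addr_ge0// sumr_ge0.
apply: ler_sum => j _; rewrite normrM (ger0_norm (wpair_ge0 _)).
by rewrite ler_wpM2l ?wpair_ge0.
Qed.

Lemma noise_mean0 i t q : i \notin S ->
  \sum_a wpair ws wd a * noise i t (upd _ q t a) = 0.
Proof.
move=> iS; pose y := traj S x0 q t.
have yE a : traj S x0 (upd _ q t a) t = y.
  by apply: traj_adapted => s st; rewrite /upd ltn_eqF.
pose J (p : 'I_n * 'I_n) := 2^-1 *
  ((p.1 == i)%:R * (y p.2 0 - y i 0) + (p.2 == i)%:R * (y p.1 0 - y i 0)).
have e a : noise i t (upd _ q t a) = J a - drift i y.
  rewrite /noise [traj _ _ _ t.+1]/= yE {1 2}/upd eqxx Rmat_regular//.
  by rewrite [X in X - _]addrAC subrr add0r.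
under eq_bigr do rewrite e mulrBr.
by rewrite sumrB mean_jump -mulr_suml sum_wpair mul1r subrr.
Qed.

Lemma savgE q t (i : 'I_n) :
  savg S x0 q t i = t.+1%:R^-1 * \sum_(s < t.+1) traj S x0 q s i 0.
Proof.
elim: t => [|t IH]; first by rewrite big_ord1 invr1 mul1r.
rewrite big_ord_recr mulrDr /= IH; congr (_ + _).
have : t.+1%:R != 0 :> R by rewrite pnatr_eq0.
have : t.+2%:R != 0 :> R by rewrite pnatr_eq0.
move: t.+1%:R t.+2%:R (\sum_(_ < _) _) => a b y b0 a0; field.
by rewrite a0 b0.
Qed.

Lemma traj_stubborn q t (i : 'I_n) : i \in S -> traj S x0 q t i 0 = x0 i 0.
Proof. by move=> iS; elim: t => [//|t IH]; rewrite [traj _ _ _ _]/= Rmat_stubborn. Qed.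

Lemma savg_stubborn q t (i : 'I_n) : i \in S -> savg S x0 q t i = x0 i 0.
Proof.
move=> iS; rewrite savgE; under eq_bigr do rewrite traj_stubborn//.
by rewrite sumr_const card_ord -[X in _ * X]mulr_natl mulKf// pnatr_eq0.
Qed.

(** The increments telescope and the drift is linear, so the drift of the time average equals a
    bounded boundary term over the number of steps minus the averaged noise. *)
Lemma cvg_savg_drift q (i : 'I_n) :
  (fun t => (\sum_(s < t) noise i s q) / t%:R) @ \oo --> (0 : R) ->
  (fun t => \sum_j wpair ws wd (i, j) * (savg S x0 q t j - savg S x0 q t i))
    @ \oo --> (0 : R).
Proof.
move=> cn; pose K := \sum_j `|x0 j 0|.
have M t : \sum_(s < t) noise i s q = traj S x0 q t i 0 - x0 i 0 -
    \sum_(s < t) drift i (traj S x0 q s).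
  elim: t => [|t IH]; first by rewrite !big_ord0 subrr subr0.
  by rewrite !big_ord_recr /= IH /noise /=; ring.
have -> : (fun t => \sum_j wpair ws wd (i, j) * (savg S x0 q t j - savg S x0 q t i)) =
    (fun t => (traj S x0 q t.+1 i 0 - x0 i 0) * t.+1%:R^-1
            - (\sum_(s < t.+1) noise i s q) / t.+1%:R).
  apply/funext => t; rewrite M.
  have -> : \sum_j wpair ws wd (i, j) * (savg S x0 q t j - savg S x0 q t i) =
     t.+1%:R^-1 * \sum_(s < t.+1) drift i (traj S x0 q s).
    rewrite /drift exchange_big mulr_sumr; apply: eq_bigr => j _.
    by rewrite -mulr_sumr !savgE sumrB; ring.
  ring.
have h2 : (fun t => (\sum_(s < t.+1) noise i s q) / t.+1%:R) @ \oo --> (0 : R).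
  by have := cn; rewrite -(cvg_shiftS (fun t => (\sum_(s < t) noise i s q) / t%:R)).
have h1 : (fun t => (traj S x0 q t.+1 i 0 - x0 i 0) * t.+1%:R^-1) @ \oo --> (0 : R).
  have K0 : 0 <= K by apply: sumr_ge0.
  apply/cvgrPdist_le => e e0; have := @cvg_harmonic R.
  (* The added 1 keeps the denominator positive when [K = 0]. *)
  move=> /cvgrPdist_le /(_ (e / (K + K + 1))) [|N _ hN].
    by rewrite divr_gt0// ltr_pwDr// addr_ge0.
  exists N => // t /hN /=; rewrite !sub0r !normrN normfV normr_nat normrM normfV normr_nat.
  rewrite ler_pdivlMr; last by rewrite ltr_pwDr// addr_ge0.
  apply: le_trans; rewrite mulrC ler_wpM2l ?invr_ge0//.
  rewrite ler_wpDr// (le_trans (ler_normB _ _))// lerD//.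
    exact: (traj_bound q t.+1).
  exact: (traj_bound q 0).
have := cvgB h1 h2; rewrite subr0; exact.
Qed.

End GossipMean.

(** * Limits of the time averages *)

Lemma cvg_sumR (R : realType) (I : Type) (r : seq I) (Q : pred I) (f : I -> nat -> R)
    (a : I -> R) : (forall i, Q i -> f i @ \oo --> a i) ->
  (fun t => \sum_(i <- r | Q i) f i t) @ \oo --> \sum_(i <- r | Q i) a i.
Proof. by move=> fa; apply: cvg_big => //; exact: add_continuous. Qed.

Lemma cvg_cramer (R : realType) (u v e f : nat -> R) (a b c d : R) (le lf : R) :
  a * d - b * c != 0 ->
  (forall t, a * u t + b * v t = e t) -> (forall t, c * u t + d * v t = f t) ->
  e @ \oo --> le -> f @ \oo --> lf ->
  u @ \oo --> (d * le - b * lf) / (a * d - b * c).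
Proof.
move=> det eq1 eq2 ce cf.
have -> : u = (fun t => (d * e t - b * f t) / (a * d - b * c)).
  by apply/funext => t; rewrite -eq1 -eq2; field.
by apply: cvgMl; apply: cvgB; apply: cvgMr.
Qed.

Section MeanField.
Context (R : realType) (n1 n2 : nat).
Local Notation n := (n1 + n2)%N.
Context (S : {set 'I_n}) (x0 : 'cV[R]_n) (ws wd : R).
Context (q : nat -> 'I_n * 'I_n).

(** Stating results for an ordered pair of labels treats both communities at once, and later lets
    [k] be whichever has the larger limit. *)
Definition other (k l : nat) := (k = 1%N /\ l = 2%N) \/ (k = 2%N /\ l = 1%N).

Lemma comm12 (i : 'I_n) : comm i = 1%N \/ comm i = 2%N.
Proof. by rewrite /comm; case: ifP; [left|right]. Qed.

Lemma comm_other k l (i : 'I_n) : other k l -> comm i = k \/ comm i = l.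
Proof. by move=> [] [-> ->]; have [->|->] := comm12 i; [left|right|right|left]. Qed.

Lemma other_neq k l : other k l -> (k == l) = false.
Proof. by move=> [] [-> ->]. Qed.

Lemma sum_regular k l (F : 'I_n -> R) : other k l ->
  \sum_(i in ~: S) F i = \sum_(i in Vr S k) F i + \sum_(i in Vr S l) F i.
Proof.
move=> kl; have nkl := other_neq _ _ kl.
rewrite big_mkcond [X in _ = X + _]big_mkcond [X in _ = _ + X]big_mkcond -big_split.
apply: eq_bigr => i _; rewrite /Vr !inE /=.
by case: (i \in S); have [->|->] := comm_other _ _ i kl;
  rewrite ?eqxx ?nkl ?[l == k]eq_sym ?nkl /= ?addr0 ?add0r.
Qed.

Lemma sum_blocks k l (F : 'I_n -> R) : other k l ->
  \sum_i F i = (\sum_(i in Vr S k) F i + \sum_(i in Vs S k) F i) +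
    (\sum_(i in Vr S l) F i + \sum_(i in Vs S l) F i).
Proof.
move=> kl; have nkl := other_neq _ _ kl.
rewrite ![\sum_(i in _) _]big_mkcond -!big_split.
apply: eq_bigr => i _; rewrite /Vr /Vs !inE /=.
by case: (i \in S); have [->|->] := comm_other _ _ i kl;
  rewrite ?eqxx ?nkl ?[l == k]eq_sym ?nkl /= ?addr0 ?add0r.
Qed.

Definition csize (k : nat) : R := #|[set i : 'I_n | comm i == k]%SET|%:R.

Lemma csize_split k : csize k = #|Vr S k|%:R + #|Vs S k|%:R.
Proof.
rewrite -natrD; congr (_%:R); rewrite -cardsUI.
have -> : Vr S k :&: Vs S k = finset.set0.
  by apply/setP => i; rewrite !inE; case: (i \in S); rewrite ?andbF.
rewrite cards0 addn0; congr #|pred_of_set _|; apply/setP => i.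
by rewrite !inE; case: (i \in S); rewrite ?orbF.
Qed.

Lemma csizeE k : csize k =
  n1%:R * (1%N == k)%:R + n2%:R * (2%N == k)%:R.
Proof.
rewrite -(sum_comm _ _ _ (fun m => (m == k)%:R)) /csize -sum1_card natr_sum.
by rewrite big_mkcond; apply: eq_bigr => i _; rewrite inE; case: (comm i == k).
Qed.

Definition xsum (k : nat) : R := \sum_(i in Vs S k) x0 i 0.
Definition ssum (k : nat) (t : nat) : R := \sum_(i in Vr S k) savg S x0 q t i.

Hypothesis ws0 : 0 < ws.
Hypothesis wd0 : 0 < wd.
Hypothesis nr0 : forall k l, other k l -> (0 < #|Vr S k|)%N.
Hypothesis ns0 : forall k l, other k l -> (0 < #|Vs S k|)%N.
Hypothesis noise0 : forall i, i \notin S ->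
  (fun t => (\sum_(s < t) noise R n1 n2 S x0 ws wd i s q) / t%:R) @ \oo --> (0 : R).

Definition imbalance (i : 'I_n) (t : nat) : R :=
  \sum_j wpair ws wd (i, j) * (savg S x0 q t j - savg S x0 q t i).

(** The weights depend on communities only and stubborn averages are constant. Hence, up to a
    vanishing imbalance, [savg] of [i] is determined by the two regular block sums and the community
    of [i]. *)
Lemma imbalanceE k l i t : other k l -> i \in Vr S k ->
  imbalance i t = ws * (ssum k t + xsum k) + wd * (ssum l t + xsum l) -
    (ws * csize k + wd * csize l) * savg S x0 q t i.
Proof.
move=> kl; rewrite !inE => /andP[iS /eqP ik]; have nkl := other_neq _ _ kl.
pose W m := if k == m then ws else wd.
have part m : \sum_(j in Vr S m) wpair ws wd (i, j) * (savg S x0 q t j - savg S x0 q t i)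
    + \sum_(j in Vs S m) wpair ws wd (i, j) * (savg S x0 q t j - savg S x0 q t i) =
    W m * (ssum m t + xsum m - csize m * savg S x0 q t i).
  have -> : \sum_(j in Vr S m) wpair ws wd (i, j) * (savg S x0 q t j - savg S x0 q t i)
      = W m * (ssum m t - #|Vr S m|%:R * savg S x0 q t i).
    rewrite mulr_natl -sumr_const -sumrB mulr_sumr; apply: eq_bigr => j.
    by rewrite !inE /wpair /= ik => /andP[_ /eqP ->].
  have -> : \sum_(j in Vs S m) wpair ws wd (i, j) * (savg S x0 q t j - savg S x0 q t i)
      = W m * (xsum m - #|Vs S m|%:R * savg S x0 q t i).
    rewrite mulr_natl -sumr_const -sumrB mulr_sumr; apply: eq_bigr => j.
    by rewrite !inE /wpair /= ik => /andP[jS /eqP ->]; rewrite savg_stubborn.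
  by rewrite csize_split; ring.
rewrite /imbalance (sum_blocks k l)// !part /W eqxx nkl; ring.
Qed.

Lemma cvg_imbalance i : i \notin S -> imbalance i @ \oo --> (0 : R).
Proof. by move=> iS; apply: cvg_savg_drift => //; exact: noise0. Qed.

(** Summing [imbalanceE] over the regular agents of each community gives a 2x2 linear system for the
    block sums with convergent right-hand sides. *)
Lemma cvg_ssum k l : other k l -> exists u : R, ssum k @ \oo --> u.
Proof.
move=> kl; have lk : other l k by case: kl => -[-> ->]; [right|left].
have rowE k' l' : other k' l' -> forall t,
    (ws * #|Vs S k'|%:R + wd * csize l') * ssum k' t +
    (- (#|Vr S k'|%:R * wd)) * ssum l' t =
    #|Vr S k'|%:R * (ws * xsum k' + wd * xsum l') - \sum_(i in Vr S k') imbalance i t.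
  move=> kl' t; rewrite (eq_bigr _ (fun i => imbalanceE k' l' i t kl')).
  rewrite sumrB -mulr_sumr -/(ssum k' t) sumr_const -[_ *+ #|_|]mulr_natl.
  by rewrite (csize_split k'); ring.
have cvgE k' l' : other k' l' -> (fun t => #|Vr S k'|%:R * (ws * xsum k' + wd * xsum l')
    - \sum_(i in Vr S k') imbalance i t) @ \oo -->
    #|Vr S k'|%:R * (ws * xsum k' + wd * xsum l') - \sum_(i in Vr S k') (0 : R).
  move=> kl'; apply: cvgB; first exact: cvg_cst.
  by apply: cvg_sumR => i; rewrite !inE => /andP[iS _]; exact: cvg_imbalance.
have row2 t : - (#|Vr S l|%:R * wd) * ssum k t +
    (ws * #|Vs S l|%:R + wd * csize k) * ssum l t =
    #|Vr S l|%:R * (ws * xsum l + wd * xsum k) - \sum_(i in Vr S l) imbalance i t.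
  by rewrite addrC rowE.
eexists; apply: (cvg_cramer _ _ _ _ _ _ _ _ _ _ _ _ (rowE k l kl) row2
  (cvgE k l kl) (cvgE l k lk)).
rewrite gt_eqF// !csize_split.
have := ns0 k l kl; have := ns0 l k lk; rewrite -!(ltr0n R).
have := ler0n R #|Vr S k|; have := ler0n R #|Vr S l|.
move: (#|Vr S k|%:R) (#|Vs S k|%:R) (#|Vr S l|%:R) (#|Vs S l|%:R) => r s r' s' r0 r'0 s0 s'0.
(* The negative term cancels against [wd * wd * (r' * r)]; the rest is nonnegative, and
   [ws * ws * (s * s')] is positive thanks to the stubborn agents. *)
have -> : (ws * s + wd * (r' + s')) * (ws * s' + wd * (r + s)) - - (r * wd) * - (r' * wd)
  = ws * ws * (s * s') + ws * wd * (s * (r + s)) + ws * wd * (s' * (r' + s')) +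
    wd * wd * (r' * s + s' * r + s' * s) by ring.
have [? ? ? ?] : [/\ 0 <= ws, 0 <= wd, 0 <= s & 0 <= s'] by split; exact: ltW.
by do 3 (apply: ltr_wpDr; first by rewrite !(mulr_ge0, addr_ge0)); rewrite !mulr_gt0.
Qed.

Lemma mean_field_limit : exists a : nat -> R,
  (forall i, i \notin S -> (fun t => savg S x0 q t i) @ \oo --> a (comm i)) /\
  (forall k l, other k l -> (ws * csize k + wd * csize l) * a k =
    ws * (#|Vr S k|%:R * a k + xsum k) + wd * (#|Vr S l|%:R * a l + xsum l)).
Proof.
have o12 : other 1 2 by left.
have o21 : other 2 1 by right.
have [u1 cu1] := cvg_ssum _ _ o12.
have [u2 cu2] := cvg_ssum _ _ o21.
pose u k := if k == 1%N then u1 else u2.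
have cu k l : other k l -> ssum k @ \oo --> u k by case=> -[-> _].
(* For labels 1 and 2, [3 - k] is the other one. *)
pose a k := (ws * (u k + xsum k) + wd * (u (3 - k)%N + xsum (3 - k)%N)) /
  (ws * csize k + wd * csize (3 - k)%N).
have oE k l : other k l -> l = (3 - k)%N by case=> -[-> ->].
have D0 k l : other k l -> ws * csize k + wd * csize l != 0.
  move=> kl; rewrite gt_eqF// ltr_wpDr ?mulr_ge0 ?ler0n ?(ltW wd0)// mulr_gt0//.
  by rewrite csize_split ltr_wpDr ?ler0n// ltr0n (nr0 k l).
have cs k l i : other k l -> i \in Vr S k ->
    (fun t => savg S x0 q t i) @ \oo --> a k.
  move=> kl ik; have lk : other l k by case: kl => -[-> ->]; [right|left].
  have iS : i \notin S by move: ik; rewrite !inE => /andP[].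
  rewrite /a -(oE _ _ kl).
  have -> : (fun t => savg S x0 q t i) = (fun t => (ws * (ssum k t + xsum k)
      + wd * (ssum l t + xsum l) - imbalance i t) / (ws * csize k + wd * csize l)).
    apply/funext => t; rewrite (imbalanceE k l)//.
    by move: (D0 _ _ kl) => ?; field.
  apply: cvgMl; rewrite -[X in _ --> X]subr0; apply: cvgB; last exact: cvg_imbalance.
  apply: cvgD; apply: cvgMr; apply: cvgD;
    [exact: (cu k l)|exact: cvg_cst|exact: (cu l k)|exact: cvg_cst].
exists a; split.
  move=> i iS; have [ik|ik] := comm12 i; rewrite ik.
    by apply: (cs _ 2%N) => //; rewrite !inE iS ik.
  by apply: (cs _ 1%N) => //; rewrite !inE iS ik.
have uE k l : other k l -> u k = #|Vr S k|%:R * a k.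
  move=> kl; apply: (cvg_unique _ (cu k l kl)); first exact: norm_hausdorff.
  rewrite mulr_natl -sumr_const; apply: cvg_sumR => i ik.
  exact: (cs k l).
move=> k l kl; have lk : other l k by case: kl => -[-> ->]; [right|left].
by rewrite -(uE k l)// -(uE l k)// /a -(oE _ _ kl) mulrC mulfVK// ?D0.
Qed.

End MeanField.

(** * Labels and parameter estimates *)

Section Estimation.
Context (R : realType) (n1 n2 : nat).
Local Notation n := (n1 + n2)%N.
Context (S : {set 'I_n}) (x0 : 'cV[R]_n) (ws wd : R).
Context (jmap : 'I_n -> 'I_n) (C0 : 'I_n -> nat) (w0 v0 : R).
Context (q : nat -> 'I_n * 'I_n) (a : nat -> R).
Local Notation N k := (csize R n1 n2 k).
Local Notation nr k := (#|Vr S k|%:R : R).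
Local Notation ns k := (#|Vs S k|%:R : R).
Local Notation xs k := (xsum R n1 n2 S x0 k).
Local Notation U k := (ssum R n1 n2 S x0 q k).

Hypothesis ws0 : 0 < ws.
Hypothesis wd0 : 0 < wd.
Hypothesis nr0 : forall k l, other k l -> (0 < #|Vr S k|)%N.
Hypothesis ns0 : forall k l, other k l -> (0 < #|Vs S k|)%N.
Hypothesis jmapS : forall i, i \in S -> jmap i \notin S /\ comm (jmap i) = comm i.
Hypothesis normal : forall k l, other k l ->
  ws * (N k ^+ 2 + N l ^+ 2) + 2 * wd * N k * N l = 1.
Hypothesis savg_lim : forall i, i \notin S ->
  (fun t => savg S x0 q t i) @ \oo --> a (comm i).
Hypothesis balance : forall k l, other k l -> (ws * N k + wd * N l) * a k =
  ws * (nr k * a k + xs k) + wd * (nr l * a l + xs l).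

Lemma otherC k l : other k l -> other l k.
Proof. by case=> -[-> ->]; [right|left]. Qed.

(** If both limits were [c], the balance equations would be a homogeneous system in the total
    deviations [u], [v] of the stubborn states from [c], with determinant [ws^2 - wd^2]. Both
    stubborn averages would then equal [c]. *)
Lemma limits_neq : ws != wd -> stub_avg S x0 1 != stub_avg S x0 2 -> a 1%N != a 2%N.
Proof.
move=> wne; apply: contra_neq => a12.
have o12 : other 1 2 by left.
have := balance _ _ o12; have := balance _ _ (otherC _ _ o12).
have s1 := ns0 _ _ o12; have s2 := ns0 _ _ (otherC _ _ o12).
have n1s := csize_split R n1 n2 S 1; have n2s := csize_split R n1 n2 S 2.
rewrite a12 n1s n2s => e2 e1; set c := a 2%N in e1 e2.
pose u := ns 1%N * c - xs 1%N; pose v := ns 2%N * c - xs 2%N.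
have f1 : ws * u + wd * v = 0.
  by rewrite /u /v; lra.
have f2 : ws * v + wd * u = 0.
  by rewrite /u /v; lra.
have w2 : (ws - wd) * (ws + wd) != 0.
  by rewrite mulf_neq0 ?subr_eq0// gt_eqF// addr_gt0.
have u0 : u = 0.
  apply: (mulfI w2); rewrite mulr0.
  transitivity (ws * (ws * u + wd * v) - wd * (ws * v + wd * u)); first by ring.
  by rewrite f1 f2 !mulr0 subrr.
have v0' : v = 0.
  apply: (mulfI w2); rewrite mulr0.
  transitivity (ws * (ws * v + wd * u) - wd * (ws * u + wd * v)); first by ring.
  by rewrite f1 f2 !mulr0 subrr.
have -> : stub_avg S x0 1 = c.
  rewrite /stub_avg -/(xs 1%N); move/eqP: u0; rewrite subr_eq0 => /eqP <-.
  by rewrite mulKf// pnatr_eq0 -lt0n.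
rewrite /stub_avg -/(xs 2%N); move/eqP: v0'; rewrite subr_eq0 => /eqP <-.
by rewrite mulKf// pnatr_eq0 -lt0n.
Qed.

Lemma cvg_ssum_block k : U k @ \oo --> nr k * a k.
Proof.
rewrite mulr_natl -sumr_const; apply: cvg_sumR => i.
by rewrite !inE => /andP[iS /eqP <-]; exact: savg_lim.
Qed.

(** From here on [k] is the community with the larger limit, the one that the algorithm eventually
    labels 1. *)
Context (k l : nat).
Hypothesis kl : other k l.
Hypothesis alk : a l < a k.

Let nrk0 : 0 < nr k. Proof. by rewrite ltr0n (nr0 k l). Qed.
Let nrl0 : 0 < nr l. Proof. by rewrite ltr0n (nr0 l k)//; exact: otherC. Qed.
Let Nk0 : 0 < N k.
Proof. by rewrite (csize_split R n1 n2 S) ltr_wpDr. Qed.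
Let Nl0 : 0 < N l.
Proof. by rewrite (csize_split R n1 n2 S) ltr_wpDr. Qed.

Lemma cvg_sbar : sbar S x0 q @ \oo --> (nr k + nr l)^-1 * (nr k * a k + nr l * a l).
Proof.
have -> : sbar S x0 q = (fun t => (nr k + nr l)^-1 * (U k t + U l t)).
  apply/funext => t; rewrite /sbar (sum_regular _ _ _ _ k l)//; congr (_^-1 * _).
  have := sum_regular R n1 n2 S k l (fun=> 1) kl.
  by rewrite !sumr_const.
by apply: cvgMr; apply: cvgD; exact: cvg_ssum_block.
Qed.

(** Both communities have regular agents, so the limit [b] of the overall mean lies strictly between
    [a l] and [a k], and each regular agent's comparison with it settles. *)
Lemma near_labels : \forall t \near \oo, forall i,
  Chat S x0 jmap C0 q t i = if comm i == k then 1%N else 2%N.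
Proof.
set b := (nr k + nr l)^-1 * (nr k * a k + nr l * a l).
have nn0 : 0 < nr k + nr l by rewrite addr_gt0.
have bk : b < a k.
  rewrite /b mulrC ltr_pdivrMr// mulrDr [a k * nr k]mulrC ltrD2l mulrC.
  by rewrite ltr_pM2r.
have lb : a l < b.
  rewrite /b mulrC ltr_pdivlMr// mulrDr [a l * nr l]mulrC ltrD2r mulrC.
  by rewrite ltr_pM2l.
have reg : \forall t \near \oo, forall i, i \notin S ->
    lab S x0 q t i = if comm i == k then 1%N else 2%N.
  apply: filter_forall => i; have [iS|iS] := boolP (i \in S).
    by apply: nearW.
  have cd : (fun t => savg S x0 q t i - sbar S x0 q t) @ \oo --> a (comm i) - b.
    by apply: cvgB; [exact: savg_lim|exact: cvg_sbar].
  have [ik|il] := comm_other _ _ _ _ i kl.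
    have : \forall t \near \oo, 0 < savg S x0 q t i - sbar S x0 q t.
      by apply: (cvgr_gt _ cd); rewrite ik subr_gt0.
    by apply: filterS => t; rewrite subr_gt0 /lab ik eqxx => ->.
  have : \forall t \near \oo, savg S x0 q t i - sbar S x0 q t < 0.
    by apply: (cvgr_lt _ cd); rewrite il subr_lt0.
  apply: filterS => t; rewrite subr_lt0 /lab il [l == k]eq_sym (other_neq k l)// => h _.
  by rewrite ltNge (ltW h).
(* Time 0 is excluded, where the labels are the arbitrary [C0]; stubborn agents copy the label of
   [jmap i]. *)
case: reg => M _ hM; exists M.+1 => // -[//|t] Mt i /=.
have {}hM := hM t.+1 (ltnW Mt).
case: ifPn => iS; last exact: hM.
by have [jS <-] := jmapS i iS; exact: hM.
Qed.

(** This places the target [ws] inside the truncation interval of the estimator. *)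
Lemma ws_lt1 : ws < 1.
Proof.
have N1 : 1 <= N k by rewrite ler1n -(ltr0n R).
rewrite -(normal k l kl) -[ltLHS]mulr1.
have : ws * 1 <= ws * N k ^+ 2 by rewrite ler_wpM2l ?(ltW ws0)// exprn_ege1.
have : 0 < ws * N l ^+ 2 by rewrite mulr_gt0// exprn_gt0.
have : 0 < 2 * wd * N k * N l by rewrite !mulr_gt0.
rewrite mulrDr; lra.
Qed.

(* In the limit [ws * b1 + wd * b2 = 0]; eliminating [wd] by the normalization
   turns this into [g * ws = - b2 / (2 N_k N_l)], so that the recursion for
   [wshat] is a Robbins-Monro scheme whose root is [ws]. *)
Lemma cvg_estimates :
  (fun t => (wshat S x0 jmap C0 w0 q t, wdhat S x0 jmap C0 w0 v0 q t))
    @ \oo --> (ws, wd).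
Proof.
(* [B1] and [B2] are what [beta1] and [beta2] become once the labels have settled. *)
pose B1 t := ns k / nr k * U k t - xs k.
pose B2 t := N l / nr k * U k t - U l t - xs l.
pose r := (N k ^+ 2 + N l ^+ 2) / (2 * N k * N l).
pose b1 := ns k * a k - xs k.
pose b2 := N l * a k - nr l * a l - xs l.
have nk0 : nr k != 0 by rewrite gt_eqF.
have cB1 : B1 @ \oo --> b1.
  rewrite /b1 (_ : ns k * a k = ns k / nr k * (nr k * a k)); last by field.
  by apply: cvgB; [apply: cvgMr; exact: cvg_ssum_block|exact: cvg_cst].
have cB2 : B2 @ \oo --> b2.
  rewrite /b2 (_ : N l * a k = N l / nr k * (nr k * a k)); last by field.
  apply: cvgB; last exact: cvg_cst.
  by apply: cvgB; [apply: cvgMr|]; exact: cvg_ssum_block.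
have eqs : \forall t \near \oo,
    [/\ nhat S x0 jmap C0 q t 1 = N k, nhat S x0 jmap C0 q t 2 = N l,
     beta1 S x0 jmap C0 q t = B1 t & beta2 S x0 jmap C0 q t = B2 t].
  apply: filterS near_labels => t lab_t.
  have c1 i : (Chat S x0 jmap C0 q t i == 1%N) = (comm i == k).
    by rewrite lab_t; case: ifP.
  have c2 i : (Chat S x0 jmap C0 q t i == 2%N) = (comm i == l).
    rewrite lab_t; have nkl := other_neq _ _ kl.
    by have [->|->] := comm_other _ _ _ _ i kl; rewrite ?eqxx ?nkl// [l == k]eq_sym nkl.
  have e1 : Vrh S x0 jmap C0 q t 1 = Vr S k by apply/setP => i; rewrite !inE c1.
  have e2 : Vrh S x0 jmap C0 q t 2 = Vr S l by apply/setP => i; rewrite !inE c2.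
  have e3 : Vsh S x0 jmap C0 q t 1 = Vs S k by apply/setP => i; rewrite !inE c1.
  have e4 : Vsh S x0 jmap C0 q t 2 = Vs S l by apply/setP => i; rewrite !inE c2.
  have e5 : nhat S x0 jmap C0 q t 1 = N k.
    by congr (_%:R); apply: eq_card => i; rewrite !inE c1.
  have e6 : nhat S x0 jmap C0 q t 2 = N l.
    by congr (_%:R); apply: eq_card => i; rewrite !inE c2.
  have eX m : \sum_(i in Vs S m) traj S x0 q t i 0 = xs m.
    by apply: eq_bigr => i; rewrite !inE => /andP[iS _]; rewrite traj_stubborn.
  by split => //; rewrite /beta1 /beta2 ?e6 ?e1 ?e2 ?e3 ?e4 eX.
have bal : ws * b1 + wd * b2 = 0.
  have := balance k l kl; rewrite /b1 /b2 [N k](csize_split R n1 n2 S).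
  lra.
have wdE : wd = (1 - (N k ^+ 2 + N l ^+ 2) * ws) / (2 * N k * N l).
  by rewrite -[X in X - _](normal k l kl); field; rewrite !gt_eqF.
have gE : (b1 - r * b2) * ws = - (b2 / (2 * N k * N l)).
  have -> : (b1 - r * b2) * ws = ws * b1 + wd * b2 - (wd + r * ws) * b2 by ring.
  by rewrite bal wdE /r; field; rewrite !gt_eqF.
(* Otherwise [gE] forces [b2 = 0], then [bal] forces [b1 = 0], and the balance equation of [l]
   yields [a l = a k]. *)
have g0 : b1 - r * b2 != 0.
  apply/eqP => g0; move: gE; rewrite g0 mul0r => /esym/eqP.
  rewrite oppr_eq0 mulf_eq0 invr_eq0 [2 * _ * _ == 0]gt_eqF ?mulr_gt0// orbF => /eqP b20.
  move: bal; rewrite b20 mulr0 addr0 => /eqP; rewrite mulf_eq0 gt_eqF//= => /eqP b10.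
  have := balance l k (otherC _ _ kl).
  have -> : nr l * a l + xs l = N l * a k - b2 by rewrite /b2; ring.
  have -> : nr k * a k + xs k = N k * a k - b1.
    by rewrite /b1 (csize_split R n1 n2 S); ring.
  rewrite b10 b20 !subr0 !mulrA -mulrDl => /mulfI h.
  move: alk; rewrite h ?ltxx//.
  by rewrite gt_eqF// addr_gt0// mulr_gt0.
have cg : gfun S x0 jmap C0 q @ \oo --> b1 - r * b2.
  have cr : (fun t => B1 t - r * B2 t) @ \oo --> b1 - r * b2.
    by apply: cvgB => //; exact: cvgMr.
  apply: cvg_trans cr; apply: near_eq_cvg.
  by apply: filterS eqs => t [h1 h2 h3 h4]; rewrite /gfun h1 h2 h3 h4.
pose c t := beta2 S x0 jmap C0 q t /
  (2 * nhat S x0 jmap C0 q t 1 * nhat S x0 jmap C0 q t 2).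
have cc : c @ \oo --> - ((b1 - r * b2) * ws).
  rewrite gE opprK.
  have cr : (fun t => B2 t / (2 * N k * N l)) @ \oo --> b2 / (2 * N k * N l).
    exact: cvgMl.
  apply: cvg_trans cr; apply: near_eq_cvg.
  by apply: filterS eqs => t [h1 h2 h3 h4]; rewrite /c h1 h2 h4.
have cws : wshat S x0 jmap C0 w0 q @ \oo --> ws.
  apply: (cvg_truncated_robbins_monro _ _ _ _ _ _ cg g0 cc) => //.
  by rewrite gtr0_norm// (lt_trans ws_lt1)// ltr1n.
have cwd : wdhat S x0 jmap C0 w0 v0 q @ \oo --> wd.
  rewrite [X in _ --> X]wdE.
  pose h t := (1 - (N k ^+ 2 + N l ^+ 2) * wshat S x0 jmap C0 w0 q t) / (2 * N k * N l).
  apply: (@cvg_trans _ (h @ \oo)).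
    apply: near_eq_cvg; case: eqs => M _ hM; exists M.+1 => // -[//|t] Mt.
    by have [h1 h2 _ _] := hM t.+1 (ltnW Mt); rewrite /h /wdhat h1 h2.
  by apply: cvgMl; apply: cvgB; [exact: cvg_cst|exact: cvgMr].
exact: (@cvg_pair _ _ _ _ (nbhs ws) (nbhs wd) _ _ _ _ _ cws cwd).
Qed.

End Estimation.

(** * From single sample paths to almost sure convergence *)

Theorem theorem5 (R : realType) (n1 n2 : nat)
  (S : {set 'I_(n1 + n2)}) (jmap : 'I_(n1 + n2) -> 'I_(n1 + n2))
  (x0 : 'cV[R]_(n1 + n2)) (ws wd : R)
  (C0 : 'I_(n1 + n2) -> nat) (ws0 wd0 : R)
  (d : measure_display) (T : measurableType d) (P : probability T R)
  (pairs : nat -> T -> 'I_(n1 + n2) * 'I_(n1 + n2)) :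
  (0 < #|Vr S 1|)%N ->
  (0 < #|Vr S 2|)%N ->
  (0 < #|Vs S 1|)%N ->
  (0 < #|Vs S 2|)%N ->
  0 < ws -> 0 < wd -> ws != wd ->
  ws * (n1%:R ^+ 2 + n2%:R ^+ 2) + 2 * wd * n1%:R * n2%:R = 1 ->
  stub_avg S x0 1 != stub_avg S x0 2 ->
  (forall i, i \in S -> jmap i \notin S /\ comm (jmap i) = comm i) ->
  (* the drawn pairs are i.i.d. with law w_{ij} *)
  (forall (t : nat) (q : nat -> 'I_(n1 + n2) * 'I_(n1 + n2)),
      measurable [set w | forall s, (s < t)%N -> pairs s w = q s] /\
      P [set w | forall s, (s < t)%N -> pairs s w = q s]
        = (\prod_(s < t) wpair ws wd (q s))%:E) ->
  {ae P, forall w,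
      exists (T0 : nat) (pi : nat -> nat),
        ((pi 1%N = 1%N /\ pi 2%N = 2%N) \/ (pi 1%N = 2%N /\ pi 2%N = 1%N)) /\
        forall (t : nat) (i : 'I_(n1 + n2)), (T0 <= t)%N ->
          Chat S x0 jmap C0 (fun s => pairs s w) t i = pi (comm i)} /\
  {ae P, forall w,
      (fun t => (wshat S x0 jmap C0 ws0 (fun s => pairs s w) t,
                 wdhat S x0 jmap C0 ws0 wd0 (fun s => pairs s w) t))
        @ \oo --> (ws, wd)}.
Proof.
move=> r1 r2 s1 s2 ws_gt0 wd_gt0 wne normal stub jS law.
have nr0 k l : other k l -> (0 < #|Vr S k|)%N by case=> -[-> _].
have ns0 k l : other k l -> (0 < #|Vs S k|)%N by case=> -[-> _].
have N1 : csize R n1 n2 1 = n1%:R by rewrite csizeE mulr1 mulr0 addr0.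
have N2 : csize R n1 n2 2 = n2%:R by rewrite csizeE mulr1 mulr0 add0r.
have normalN k l : other k l -> ws * (csize R n1 n2 k ^+ 2 + csize R n1 n2 l ^+ 2) +
    2 * wd * csize R n1 n2 k * csize R n1 n2 l = 1.
  by case=> -[-> ->]; rewrite N1 N2 -[RHS]normal; ring.
have [C hC] := noise_bound R n1 n2 S x0 ws wd ws_gt0 wd_gt0.
have ae_noise : {ae P, forall w, forall i, i \notin S ->
    (fun t => (\sum_(s < t) noise R n1 n2 S x0 ws wd i s (pairs^~ w)) / t%:R)
      @ \oo --> (0 : R)}.
  (* There are finitely many agents, so their null sets can be united. *)
  apply: filter_forall => i; have [iS|iS] := boolP (i \in S).
    by apply: aeW => w; rewrite ?iS.
  apply: (filterS (fun w h _ => h)).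
  apply: (bounded_martingale_slln _ _ _ _ _ (wpair ws wd) pairs _ _ _ (noise R n1 n2 S x0 ws wd i) C).
  - by move=> p; exact: wpair_ge0.
  - exact: sum_wpair.
  - exact: law.
  - exact: noise_adapted.
  - exact: hC.
  - by move=> t q; exact: noise_mean0.
(* From here the argument is deterministic, along one path [q] whose averaged noise vanishes. *)
have limits q : (forall i, i \notin S ->
    (fun t => (\sum_(s < t) noise R n1 n2 S x0 ws wd i s q) / t%:R) @ \oo --> (0 : R)) ->
  exists a k l, [/\ other k l, a l < a k,
    forall i, i \notin S -> (fun t => savg S x0 q t i) @ \oo --> a (comm i) &
    forall k l, other k l -> (ws * csize R n1 n2 k + wd * csize R n1 n2 l) * a k =
      ws * (#|Vr S k|%:R * a k + xsum R n1 n2 S x0 k) +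
      wd * (#|Vr S l|%:R * a l + xsum R n1 n2 S x0 l)].
  move=> hq; have [a [cva bal]] :=
    mean_field_limit R n1 n2 S x0 ws wd q ws_gt0 wd_gt0 nr0 ns0 hq.
  have := limits_neq R n1 n2 S x0 ws wd a ws_gt0 wd_gt0 ns0 bal wne stub.
  rewrite neq_lt => /orP[lt12|lt21].
    by exists a, 2%N, 1%N; split => //; right.
  by exists a, 1%N, 2%N; split => //; left.
split; apply: filterS ae_noise => w /limits [a [k [l [kl lt cva bal]]]].
  have [M _ hM] := near_labels R n1 n2 S x0 jmap C0 _ a nr0 jS cva k l kl lt.
  exists M, (fun m => if m == k then 1%N else 2%N); split.
    by case: kl => -[-> _]; [left|right].
  by move=> t i Mt; exact: hM.
exact: (cvg_estimates R n1 n2 S x0 ws wd jmap C0 ws0 wd0 _ a _ _ nr0 jS normalN cva bal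
  k l kl lt).
Qed.
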